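(* Let $\omega$ be a nonzero real number, $q=e^{-2\omega}$, and let $\mathcal{P}=\mathcal{P}(q)$ be the unital associative $\mathbb{C}$-algebra with generators $K,A,B,C$ and the relations listed in the context. Let $\mathcal{L}(\mathcal{P})$ be the Lie subalgebra of $\mathcal{P}$ (with respect to the commutator $[X,Y]=XY-YX$) generated by $K,A,B,C$. Then $\mathcal{L}(\mathcal{P})$ is precisely the linear span of all the elements $$K^hC^k,\quad K^hC^kB^l,\quad K^hC^kA^l\qquad (h,k\in\mathbb{N},\ l\in\mathbb{N}\setminus\{0\},\ \text{with } h\in\{0,1\}\text{ whenever }k\geq 1)$$ other than the multiplicative identity $1$. That is, as vector spaces, $$\mathcal{P}=\mathbb{C}1\oplus\mathcal{L}(\mathcal{P}).$$
   Context: $\mathbb{N}=\{0,1,2,\ldots\}$. For a nonzero real $\omega$ and $q=e^{-2\omega}$, real powers of $q$ are the positive real ones. $\mathcal{P}=\mathcal{P}(q)$ is the unital associative algebra over $\mathbb{C}$ with generators $K,A,B,C$ and defining relations $$AB=\frac{1-qC}{1-q},\quad BA=\frac{1-C}{1-q},\quad AC=qCA,\quad BC=q^{-1}CB,$$ $$AK=q^{-1/2}KA,\quad BK=q^{1/2}KB,\quad CK=KC,\quad K^2C=1.$$ The displayed elements $K^hC^k$, $K^hC^kB^l$, $K^hC^kA^l$ with the stated restriction on exponents form a basis of $\mathcal{P}$; the identity $1$ is the element with $h=k=0$ of the first type. *)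

(* Defs.v *)
From HB Require Import structures.
From mathcomp Require Import all_boot all_order all_algebra.
From mathcomp Require Import complex.
From mathcomp Require Import all_classical all_reals all_analysis.
From mathcomp Require Import ring lra.

Set Implicit Arguments.
Unset Strict Implicit.
Unset Printing Implicit Defensive.

Import Order.TTheory GRing.Theory Num.Theory.

Local Open Scope classical_set_scope.
Local Open Scope ring_scope.

(* Unital associative algebras presented by generators and relations: formal
   expressions in the generators, modulo the least congruence [pcongr] that
   contains the relations and makes the quotient a unital associative
   F-algebra.  The scalar c is the expression [TConst c]; c times t is
   [TMul (TConst c) t], and 0, 1, -t are c = 0, c = 1, (-1) times t. *)
Section Presentation.
Variables (F : comNzRingType) (X : Type).

Inductive term : Type :=
| TGen of X
| TConst of F
| TAdd of term & term
| TMul of term & term.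

Variable rels : term -> term -> Prop.

Inductive pcongr : term -> term -> Prop :=
| pc_rel t u : rels t u -> pcongr t u
| pc_refl t : pcongr t t
| pc_sym t u : pcongr t u -> pcongr u t
| pc_trans t u v : pcongr t u -> pcongr u v -> pcongr t v
| pc_add t t' u u' :
    pcongr t t' -> pcongr u u' -> pcongr (TAdd t u) (TAdd t' u')
| pc_mul t t' u u' :
    pcongr t t' -> pcongr u u' -> pcongr (TMul t u) (TMul t' u')
| pc_addA t u v : pcongr (TAdd t (TAdd u v)) (TAdd (TAdd t u) v)
| pc_addC t u : pcongr (TAdd t u) (TAdd u t)
| pc_add0 t : pcongr (TAdd (TConst 0) t) t
| pc_addN t : pcongr (TAdd (TMul (TConst (-1)) t) t) (TConst 0)
| pc_mulA t u v : pcongr (TMul t (TMul u v)) (TMul (TMul t u) v)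
| pc_mul1l t : pcongr (TMul (TConst 1) t) t
| pc_mul1r t : pcongr (TMul t (TConst 1)) t
| pc_mulDl t u v : pcongr (TMul (TAdd t u) v) (TAdd (TMul t v) (TMul u v))
| pc_mulDr t u v : pcongr (TMul t (TAdd u v)) (TAdd (TMul t u) (TMul t v))
| pc_constD a b : pcongr (TConst (a + b)) (TAdd (TConst a) (TConst b))
| pc_constM a b : pcongr (TConst (a * b)) (TMul (TConst a) (TConst b))
| pc_constC a t : pcongr (TMul (TConst a) t) (TMul t (TConst a)).

HB.instance Definition _ := gen_eqMixin term.
HB.instance Definition _ := gen_choiceMixin term.

Definition pcongrb (t u : term) : bool := `[< pcongr t u >].

Lemma pcongrb_equiv : equiv_class_of pcongrb.
Proof.
split=> [t|t u|t u v]; first exact/asboolP/pc_refl.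
- by apply/asboolP/asboolP => /pc_sym.
- by move=> /asboolP h1 /asboolP h2; apply/asboolP; apply: pc_trans h1 h2.
Qed.

Canonical pcongr_equivRel := EquivRelPack pcongrb_equiv.

Local Open Scope quotient_scope.

Definition presented : Type := {eq_quot pcongrb}.

HB.instance Definition _ := Choice.on presented.
HB.instance Definition _ := EqQuotient.on presented.

Definition pclass (t : term) : presented := \pi t.

Lemma pclassP t u : pclass t = pclass u <-> pcongr t u.
Proof.
split=> [/eqP|h]; first by rewrite eqmodE => /asboolP.
by apply/eqP; rewrite eqmodE; apply/asboolP.
Qed.

Lemma pclass_surj (x : presented) : exists t, x = pclass t.
Proof. by exists (repr x); rewrite /pclass reprK. Qed.

Lemma pcongr_repr t : pcongr (repr (pclass t)) t.
Proof. by apply/pclassP; rewrite /pclass reprK. Qed.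

Definition padd (x y : presented) := pclass (TAdd (repr x) (repr y)).
Definition pmul (x y : presented) := pclass (TMul (repr x) (repr y)).
Definition popp (x : presented) := pmul (pclass (TConst (-1))) x.
Definition pscale (c : F) (x : presented) := pmul (pclass (TConst c)) x.

Lemma pclassD t u : pclass (TAdd t u) = padd (pclass t) (pclass u).
Proof. by apply/pclassP/pc_sym; apply: pc_add; apply: pcongr_repr. Qed.

Lemma pclassM t u : pclass (TMul t u) = pmul (pclass t) (pclass u).
Proof. by apply/pclassP/pc_sym; apply: pc_mul; apply: pcongr_repr. Qed.

Lemma paddA : associative padd.
Proof.
move=> x y z; have [t ->] := pclass_surj x; have [u ->] := pclass_surj y.
by have [v ->] := pclass_surj z; rewrite -!pclassD; apply/pclassP/pc_addA.
Qed.

Lemma paddC : commutative padd.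
Proof.
move=> x y; have [t ->] := pclass_surj x; have [u ->] := pclass_surj y.
by rewrite -!pclassD; apply/pclassP/pc_addC.
Qed.

Lemma padd0 : left_id (pclass (TConst 0)) padd.
Proof.
by move=> x; have [t ->] := pclass_surj x; rewrite -!pclassD;
  apply/pclassP/pc_add0.
Qed.

Lemma paddN : left_inverse (pclass (TConst 0)) popp padd.
Proof.
by move=> x; have [t ->] := pclass_surj x; rewrite /popp -pclassM -pclassD;
  apply/pclassP/pc_addN.
Qed.

HB.instance Definition _ := GRing.isZmodule.Build presented
  paddA paddC padd0 paddN.

Lemma pmulA : associative pmul.
Proof.
move=> x y z; have [t ->] := pclass_surj x; have [u ->] := pclass_surj y.
by have [v ->] := pclass_surj z; rewrite -!pclassM; apply/pclassP/pc_mulA.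
Qed.

Lemma pmul1l : left_id (pclass (TConst 1)) pmul.
Proof.
by move=> x; have [t ->] := pclass_surj x; rewrite -pclassM;
  apply/pclassP/pc_mul1l.
Qed.

Lemma pmul1r : right_id (pclass (TConst 1)) pmul.
Proof.
by move=> x; have [t ->] := pclass_surj x; rewrite -pclassM;
  apply/pclassP/pc_mul1r.
Qed.

Lemma pmulDl : left_distributive pmul padd.
Proof.
move=> x y z; have [t ->] := pclass_surj x; have [u ->] := pclass_surj y.
have [v ->] := pclass_surj z; rewrite -pclassD -!pclassM -pclassD.
exact/pclassP/pc_mulDl.
Qed.

Lemma pmulDr : right_distributive pmul padd.
Proof.
move=> x y z; have [t ->] := pclass_surj x; have [u ->] := pclass_surj y.
have [v ->] := pclass_surj z; rewrite -pclassD -!pclassM -pclassD.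
exact/pclassP/pc_mulDr.
Qed.

HB.instance Definition _ := GRing.Zmodule_isPzRing.Build presented
  pmulA pmul1l pmul1r pmulDl pmulDr.

Lemma pscaleA a b x : pscale a (pscale b x) = pscale (a * b) x.
Proof.
rewrite /pscale pmulA -pclassM; congr pmul; apply/pclassP/pc_sym.
exact: pc_constM.
Qed.

Lemma pscale1 : left_id 1 pscale.
Proof. exact: pmul1l. Qed.

Lemma pscaleDr : right_distributive pscale +%R.
Proof. by move=> c; apply: pmulDr. Qed.

Lemma pscaleDl x : {morph pscale^~ x : a b / a + b}.
Proof.
move=> a b; rewrite /pscale -[RHS]pmulDl; congr pmul.
by rewrite -pclassD; apply/pclassP/pc_constD.
Qed.

HB.instance Definition _ := GRing.Zmodule_isLmodule.Build F presented
  pscaleA pscale1 pscaleDr pscaleDl.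

Lemma presented_scaleAl (c : F) (x y : presented) : c *: (x * y) = (c *: x) * y.
Proof. exact: pmulA. Qed.

Lemma presented_scaleAr (c : F) (x y : presented) : c *: (x * y) = x * (c *: y).
Proof.
rewrite [LHS]pmulA [RHS]pmulA; congr pmul.
have [t ->] := pclass_surj x; rewrite -!pclassM; apply/pclassP; exact: pc_constC.
Qed.

Definition pgen (x : X) : presented := pclass (TGen x).

Fixpoint teval (S : algType F) (g : X -> S) (t : term) : S :=
  match t with
  | TGen x => g x
  | TConst c => c%:A
  | TAdd t u => teval g t + teval g u
  | TMul t u => teval g t * teval g u
  end.

Lemma teval_pcongr (S : algType F) (g : X -> S) :
  (forall t u, rels t u -> teval g t = teval g u) ->
  forall t u, pcongr t u -> teval g t = teval g u.
Proof.
move=> grel t u; elim=> //=.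
- by move=> {}t {}u v _ -> _ ->.
- by move=> {}t t' {}u u' _ -> _ ->.
- by move=> {}t t' {}u u' _ -> _ ->.
- by move=> *; rewrite addrA.
- by move=> *; rewrite addrC.
- by move=> *; rewrite scale0r add0r.
- by move=> *; rewrite scaleN1r mulN1r addNr scale0r.
- by move=> *; rewrite mulrA.
- by move=> *; rewrite scale1r mul1r.
- by move=> *; rewrite scale1r mulr1.
- by move=> *; rewrite mulrDl.
- by move=> *; rewrite mulrDr.
- by move=> *; rewrite scalerDl.
- by move=> *; rewrite mulr_algl scalerA.
- by move=> *; rewrite mulr_algl mulr_algr.
Qed.

(* The universal property of the presented algebra. *)
Lemma presented_universal (S : algType F) (g : X -> S) :
  (forall t u, rels t u -> teval g t = teval g u) ->
  exists! f : presented -> S,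
    [/\ forall x, f (pgen x) = g x, linear f & monoid_morphism f].
Proof.
move=> grel; pose f (x : presented) := teval g (repr x).
have fE t : f (pclass t) = teval g t.
  exact: (teval_pcongr grel (pcongr_repr t)).
exists f; split.
  split=> [x|c x y|]; first exact: fE.
    have [t ->] := pclass_surj x; have [u ->] := pclass_surj y.
    rewrite -[_ *: _ + _]/(padd (pmul (pclass (TConst c)) _) _).
    by rewrite -pclassM -pclassD !fE /= mulr_algl.
  split=> [|x y]; first by rewrite [f _]fE /= scale1r.
  have [t ->] := pclass_surj x; have [u ->] := pclass_surj y.
  by rewrite -[_ * _]/(pmul _ _) -pclassM !fE.
move=> f' [f'g f'l [f'1 f'M]]; apply/funext => x.
have [t ->] := pclass_surj x; rewrite fE.
have f'0 : f' 0 = 0.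
  have := f'l (-1) 0 0; rewrite scaler0 addr0 scaleN1r addrC => ->.
  by rewrite subrr.
have f'Z c y : f' (c *: y) = c *: f' y by have := f'l c y 0; rewrite !addr0 f'0 addr0.
have f'D y z : f' (y + z) = f' y + f' z by have := f'l 1 y z; rewrite !scale1r.
elim: t => [y|c|t IHt u IHu|t IHt u IHu] /=.
- exact/esym/f'g.
- rewrite -f'1 -f'Z; congr f'; exact: pmul1r.
- by rewrite IHt IHu -f'D pclassD.
- by rewrite IHt IHu -f'M pclassM.
Qed.

End Presentation.

(* The algebra P(q), q = exp(-2w), over R[i].  Nothing here needs w != 0. *)
Section PolynomialAlgebra.
Variables (R : realType) (w : R).

Definition qpar : R := expR (- 2 * w).

Definition qpow (a : R) : R[i] := (qpar `^ a)%:C%C.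

Inductive generator := GK | GA | GB | GC.

Local Notation expr := (term R[i] generator).
Local Notation tK := (TGen R[i] GK).
Local Notation tA := (TGen R[i] GA).
Local Notation tB := (TGen R[i] GB).
Local Notation tC := (TGen R[i] GC).
Local Notation "a ** t" := (TMul (TConst generator a) t) (at level 40).

(* (1 - c t) / (1 - q) *)
Local Notation one_minus_over c t :=
  ((1 - qpow 1)^-1 ** TAdd (TConst generator 1) ((- c) ** t)).

Inductive Prel : expr -> expr -> Prop :=
| Prel_AB : Prel (TMul tA tB) (one_minus_over (qpow 1) tC)
| Prel_BA : Prel (TMul tB tA) (one_minus_over 1 tC)
| Prel_AC : Prel (TMul tA tC) (qpow 1 ** TMul tC tA)
| Prel_BC : Prel (TMul tB tC) (qpow (-1) ** TMul tC tB)
| Prel_AK : Prel (TMul tA tK) (qpow (- 2^-1) ** TMul tK tA)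
| Prel_BK : Prel (TMul tB tK) (qpow 2^-1 ** TMul tK tB)
| Prel_CK : Prel (TMul tC tK) (TMul tK tC)
| Prel_KKC : Prel (TMul (TMul tK tK) tC) (TConst generator 1).

Definition Palg : Type := presented Prel.

HB.instance Definition _ := GRing.PzRing.on Palg.
HB.instance Definition _ := GRing.Lmodule.on Palg.

(* Evaluation in the representation of Palg on functions f : int -> R[i] where
   A f (n) = f (n + 1), B f (n) = (1 - q^n)/(1 - q) f (n - 1),
   C f (n) = q^n f (n) and K f (n) = q^(-n/2) f (n); it serves to show that
   Palg is not the zero ring. *)
Fixpoint Prep (t : expr) (f : int -> R[i]) (n : int) : R[i] :=
  match t with
  | TGen GK => qpow (- 2^-1 * n%:~R) * f n
  | TGen GA => f (n + 1)
  | TGen GB => (1 - qpow 1)^-1 * (1 - qpow n%:~R) * f (n - 1)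
  | TGen GC => qpow n%:~R * f n
  | TConst c => c * f n
  | TAdd t u => Prep t f n + Prep u f n
  | TMul t u => Prep t (Prep u f) n
  end.

Lemma qpowD a b : qpow (a + b) = qpow a * qpow b.
Proof.
rewrite /qpow powRD ?rmorphM //.
by apply/implyP => _; rewrite gt_eqF // expR_gt0.
Qed.

Lemma qpow0 : qpow 0 = 1.
Proof. by rewrite /qpow powRr0. Qed.

Lemma Prep_linear t (c : R[i]) f g n :
  Prep t (fun m => c * f m + g m) n = c * Prep t f n + Prep t g n.
Proof.
elim: t f g n => [[]|b|t IHt u IHu|t IHt u IHu] f g n /=; try ring.
  by rewrite IHt IHu; ring.
rewrite -IHt; congr (Prep t _ n); apply/funext => m; exact: IHu.
Qed.

Lemma PrepD t f g n : Prep t (fun m => f m + g m) n = Prep t f n + Prep t g n.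
Proof.
rewrite -[Prep t f n]mul1r -Prep_linear; congr (Prep t _ n).
by apply/funext => m; rewrite mul1r.
Qed.

Lemma PrepZ t c f n : Prep t (fun m => c * f m) n = c * Prep t f n.
Proof.
have P0 : Prep t (fun=> 0) n = 0.
  rewrite -[RHS](addNr (Prep t (fun=> 0) n)) -mulN1r -Prep_linear.
  by congr (Prep t _ n); apply/funext => m; rewrite mulr0 addr0.
rewrite -[RHS]addr0 -P0 -Prep_linear; congr (Prep t _ n).
by apply/funext => m; rewrite addr0.
Qed.

Lemma Prep_rel t u : Prel t u -> Prep t = Prep u.
Proof.
case; apply/funext => f; apply/funext => n /=.
- by rewrite addrK intrD qpowD; ring.
- by rewrite subrK; ring.
- by rewrite intrD qpowD; ring.
- by rewrite intrB qpowD; ring.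
- by rewrite intrD mulrDr mulr1 qpowD; ring.
- have -> : - 2^-1 * (n - 1)%:~R = - 2^-1 * n%:~R + 2^-1 :> R by rewrite intrB; ring.
  by rewrite qpowD; ring.
- ring.
- rewrite !mulrA -!qpowD (_ : _ + _ = 0) ?qpow0 //; lra.
Qed.

Lemma Prep_pcongr t u : pcongr Prel t u -> Prep t = Prep u.
Proof.
elim=> {t u} //=.
- exact: Prep_rel.
- by move=> t u v _ -> _ ->.
- by move=> t t' u u' _ -> _ ->.
- by move=> t t' u u' _ -> _ ->.
- by move=> t u v; apply/funext => f; apply/funext => n; rewrite addrA.
- by move=> t u; apply/funext => f; apply/funext => n; rewrite addrC.
- by move=> t; apply/funext => f; apply/funext => n; rewrite mul0r add0r.
- by move=> t; apply/funext => f; apply/funext => n; rewrite mulN1r addNr mul0r.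
- by move=> t; apply/funext => f; apply/funext => n; rewrite mul1r.
- move=> t; apply/funext => f; apply/funext => n; rewrite PrepZ mul1r //.
- by move=> t u v; apply/funext => f; apply/funext => n; rewrite PrepD.
- by move=> a b; apply/funext => f; apply/funext => n; rewrite mulrDl.
- by move=> a b; apply/funext => f; apply/funext => n; rewrite mulrA.
- by move=> a t; apply/funext => f; apply/funext => n; rewrite PrepZ.
Qed.

Lemma P_oner_neq0 : (1 : Palg) != 0.
Proof.
apply/eqP => /pclassP /Prep_pcongr /(congr1 (fun F => F (fun=> 1) 0)) /=.
by rewrite mul1r mul0r => /eqP; rewrite oner_eq0.
Qed.

HB.instance Definition _ := GRing.PzSemiRing_isNonZero.Build Palg P_oner_neq0.
HB.instance Definition _ :=
  GRing.Lmodule_isLalgebra.Build R[i] Palg (@presented_scaleAl _ _ Prel).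
HB.instance Definition _ :=
  GRing.Lalgebra_isAlgebra.Build R[i] Palg (@presented_scaleAr _ _ Prel).

Definition pK : Palg := pgen Prel GK.
Definition pA : Palg := pgen Prel GA.
Definition pB : Palg := pgen Prel GB.
Definition pC : Palg := pgen Prel GC.

Definition Pmonomials : set Palg :=
  [set x | exists h k : nat, ((1 <= k)%N -> h \in [:: 0%N; 1%N]) /\
    [\/ x = pK ^+ h * pC ^+ k,
        exists2 l : nat, (0 < l)%N & x = pK ^+ h * pC ^+ k * pB ^+ l |
        exists2 l : nat, (0 < l)%N & x = pK ^+ h * pC ^+ k * pA ^+ l]].

Lemma P_relations :
  [/\ pA * pB = (1 - qpow 1)^-1 *: (1 - qpow 1 *: pC),
      pB * pA = (1 - qpow 1)^-1 *: (1 - pC),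
      pA * pC = qpow 1 *: (pC * pA) & pB * pC = qpow (-1) *: (pC * pB)] /\
  [/\ pA * pK = qpow (- 2^-1) *: (pK * pA),
      pB * pK = qpow 2^-1 *: (pK * pB),
      pC * pK = pK * pC & pK ^+ 2 * pC = 1].
Proof.
have relP t u : Prel t u -> pclass Prel t = pclass Prel u.
  by move=> tu; apply/pclassP/pc_rel.
have scE c (t : expr) : c *: (pclass Prel t : Palg) = pclass Prel (c ** t).
  by rewrite pclassM.
have mulE (t u : expr) :
    (pclass Prel t : Palg) * pclass Prel u = pclass Prel (TMul t u).
  by rewrite pclassM.
have addE (t u : expr) :
    (pclass Prel t : Palg) + pclass Prel u = pclass Prel (TAdd t u).
  by rewrite pclassD.
have oneE : 1 = pclass Prel (TConst generator 1) :> Palg by [].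
do 2![split]; rewrite ?expr2 /pA /pB /pC /pK /pgen ?oneE.
- rewrite -scaleNr (scE (- _)) addE scE mulE; exact/relP/Prel_AB.
- rewrite -[pclass Prel tC in RHS]scale1r -scaleNr (scE (- _)) addE scE mulE.
  exact/relP/Prel_BA.
- rewrite !mulE scE; exact/relP/Prel_AC.
- rewrite !mulE scE; exact/relP/Prel_BC.
- rewrite !mulE scE; exact/relP/Prel_AK.
- rewrite !mulE scE; exact/relP/Prel_BK.
- rewrite !mulE; exact/relP/Prel_CK.
- rewrite (mulE tK) mulE; exact/relP/Prel_KKC.
Qed.

End PolynomialAlgebra.

Arguments Pmonomials {R} w.

Section LieSpan.
Variables (F : comNzRingType) (V : algType F).

Definition commutator (x y : V) : V := x * y - y * x.

Definition linear_subspace (S : set V) : Prop :=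
  S 0 /\ forall (a : F) x y, S x -> S y -> S (a *: x + y).

Definition lie_subalgebra (S : set V) : Prop :=
  linear_subspace S /\ forall x y, S x -> S y -> S (commutator x y).

Definition lin_span (G : set V) : set V := smallest linear_subspace G.

Definition lie_generated (G : set V) : set V := smallest lie_subalgebra G.

(* V is the internal direct sum of U and W. *)
Definition direct_sum (U W : set V) : Prop :=
  forall x, exists! uw : V * V, [/\ U uw.1, W uw.2 & x = uw.1 + uw.2].

End LieSpan.

(* Main.v *)
Require Import Defs.
From mathcomp Require Import all_boot all_order all_algebra.
From mathcomp Require Import complex.
From mathcomp Require Import all_classical all_reals all_analysis.
From mathcomp Require Import zify ring.

Set Implicit Arguments.
Unset Strict Implicit.
Unset Printing Implicit Defensive.

Import Order.TTheory GRing.Theory Num.Theory.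
Local Open Scope classical_set_scope.
Local Open Scope ring_scope.

(* Put z_n = K^n for n in Z (K^-1 = KC), so C = z_(-2), and P is spanned by the
   z_n A^l and z_n B^l. Let S be the span of these without z_0 = 1.

   S is contained in L: [z_m A^k, z_n A^l] is a multiple of z_(m+n) A^(k+l) with
   a coefficient that is nonzero for suitable splittings, so all z_n A^l, and
   likewise z_n B^l, with l >= 1 are obtained. Then [z_n A, B] is a combination
   of z_n and z_(n-2) that links all powers of K of the same parity, except that
   1 drops out at n = 0 and n = 2.

   [P, P] is contained in S: since [x, yz] = [xy, z] + [zx, y], the y such that
   [P, y] is contained in S form a subalgebra, so it is enough to bracket with
   the generators.

   1 is not in S: in the representation on functions on Z, the diagonal matrix
   entries of the elements of S are combinations of geometric sequences of
   ratios q^(-n/2), n <> 0, which products of operators f |-> f(. + 1) - x f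
   with x <> 1 annihilate; no such product annihilates the constant 1. *)

(** * Subspaces, spans and the bilinear commutator *)

Section LinearSubspaces.
Context {F : comNzRingType} {V : algType F}.
Implicit Types (S G : set V).

Lemma lsub0 {S} : linear_subspace S -> S 0.
Proof. by case. Qed.

Lemma lsubZ {S} c x : linear_subspace S -> S x -> S (c *: x).
Proof. by move=> [S0 SL] Sx; rewrite -[_ *: _]addr0; apply: SL. Qed.

Lemma lsubD {S} x y : linear_subspace S -> S x -> S y -> S (x + y).
Proof. by move=> [_ SL] Sx Sy; rewrite -[x]scale1r; apply: SL. Qed.

Lemma lsubB {S} x y : linear_subspace S -> S x -> S y -> S (x - y).
Proof.
by move=> SL Sx Sy; apply: lsubD => //; rewrite -scaleN1r; apply: lsubZ.
Qed.

Lemma lin_span_subspace G : linear_subspace (lin_span G).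
Proof.
split=> [|c x y Gx Gy] S [SL GS]; first exact: lsub0.
by apply: SL.2; [apply: Gx|apply: Gy].
Qed.

Lemma mem_lin_span {G} x : G x -> lin_span G x.
Proof. by move=> Gx S [_]; apply. Qed.

Lemma lin_span_min {G S} : linear_subspace S -> G `<=` S -> lin_span G `<=` S.
Proof. by move=> SL GS x; apply. Qed.

Lemma lie_generated_subalgebra G : lie_subalgebra (lie_generated G).
Proof.
split; [split=> [|c x y Gx Gy]|move=> x y Gx Gy] => S [SL GS].
- exact: lsub0 SL.1.
- by apply: SL.1.2; [apply: Gx|apply: Gy].
- by apply: SL.2; [apply: Gx|apply: Gy].
Qed.

Lemma lin_span1P x : lin_span [set (1 : V)] x -> exists c, x = c%:A.
Proof.
apply: (lin_span_min (S := [set x | exists c, x = c%:A])).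
  split; first by exists 0; rewrite scale0r.
  by move=> d _ _ [b ->] [c ->]; exists (d * b + c); rewrite scalerDl scalerA.
by move=> _ ->; exists 1; rewrite scale1r.
Qed.

Lemma commutatorZl c (x y : V) : commutator (c *: x) y = c *: commutator x y.
Proof. by rewrite /commutator -scalerAl -scalerAr scalerBr. Qed.

Lemma commutatorDl (x y z : V) :
  commutator (x + y) z = commutator x z + commutator y z.
Proof. by rewrite /commutator mulrDl mulrDr opprD addrACA. Qed.

Lemma commutatorDr (x y z : V) :
  commutator x (y + z) = commutator x y + commutator x z.
Proof. by rewrite /commutator mulrDl mulrDr opprD addrACA. Qed.

Lemma commutator0l (x : V) : commutator 0 x = 0.
Proof. by rewrite /commutator mul0r mulr0 subrr. Qed.

Lemma commutatorMr (x y z : V) :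
  commutator x (y * z) = commutator (x * y) z + commutator (z * x) y.
Proof. by rewrite /commutator !mulrA addrA subrK. Qed.

End LinearSubspaces.

(** * Integer powers of an invertible element *)

Section IntegerPowers.
Context {V : nzRingType} {x y : V}.

(** The inverse [y] is an explicit argument because [V] is an arbitrary ring; [Negz k] stands for
    -(k + 1), hence the exponent [k.+1]. *)
Definition zpow (x y : V) (n : int) : V :=
  match n with Posz k => x ^+ k | Negz k => y ^+ k.+1 end.

Hypotheses (xy : x * y = 1) (yx : y * x = 1).

Lemma zpowS n : zpow x y (n + 1) = zpow x y n * x.
Proof.
case: n => [n|[|n]].
- by rewrite -PoszD addn1 /= exprSr.
- by rewrite /= expr1 yx.
- have -> : Negz n.+1 + 1 = Negz n by lia.
  by rewrite /= [y ^+ n.+2]exprSr -mulrA yx mulr1.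
Qed.

Lemma zpowB1 n : zpow x y (n - 1) = zpow x y n * y.
Proof. by rewrite -[in RHS](subrK 1 n) zpowS -mulrA xy mulr1. Qed.

Lemma zpowD m n : zpow x y (m + n) = zpow x y m * zpow x y n.
Proof.
elim/int_rec: n => [|n IHn|n IHn]; first by rewrite addr0 /= expr0 mulr1.
  by rewrite -addn1 PoszD addrA !zpowS IHn mulrA.
have -> : - n.+1%:Z = - n%:Z - 1 by lia.
by rewrite addrA !zpowB1 IHn mulrA.
Qed.

End IntegerPowers.

(** * Products and brackets of q-commuting monomials *)

Section QCommuting.
Context {F : fieldType} {V : algType F} {c : F} {K Ki X : V}.
Hypotheses (c0 : c != 0) (KKi : K * Ki = 1) (KiK : Ki * K = 1).
Hypothesis (XK : X * K = c *: (K * X)).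
Local Notation z := (zpow K Ki).

Lemma qcommute_inv : X * Ki = c^-1 *: (Ki * X).
Proof.
apply: (scalerI c0); rewrite scalerA mulfV // scale1r.
by rewrite -[RHS]mulr1 -KKi !mulrA -[Ki * X * K]mulrA XK -scalerAr -scalerAl
  mulrA KiK mul1r.
Qed.

Lemma qcommute_zpow n : X * z n = c ^ n *: (z n * X).
Proof.
elim/int_rec: n => [|n IHn|n IHn]; first by rewrite expr0z scale1r mulr1 mul1r.
  rewrite -addn1 PoszD zpowS // mulrA IHn -scalerAl -[z _ * X * K]mulrA XK.
  by rewrite -scalerAr scalerA mulrA expfzDr // expr1z.
have -> : - n.+1%:Z = - n%:Z - 1 by lia.
rewrite zpowB1 // mulrA IHn -scalerAl -[z _ * X * Ki]mulrA qcommute_inv.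
by rewrite -scalerAr scalerA mulrA expfzDr // exprN1.
Qed.

Lemma qcommute_exp_zpow l n : X ^+ l * z n = (c ^ n) ^+ l *: (z n * X ^+ l).
Proof.
elim: l => [|l IHl]; first by rewrite scale1r mulr1 mul1r.
by rewrite exprS -mulrA IHl -scalerAr mulrA qcommute_zpow -scalerAl scalerA
  -mulrA -exprS -exprSr.
Qed.

Lemma zpow_expM m n k l :
  (z m * X ^+ k) * (z n * X ^+ l) = (c ^ n) ^+ k *: (z (m + n) * X ^+ (k + l)).
Proof.
by rewrite -mulrA [X ^+ k * _]mulrA qcommute_exp_zpow -scalerAl -scalerAr
  !mulrA -zpowD // -mulrA -exprD.
Qed.

(** Both orders of the product give the same monomial, with coefficients c^(nk) and c^(ml); the
    bracket is therefore nonzero multiple information about that monomial as soon as these two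
    powers differ. *)
Lemma zpow_exp_commutator m n k l :
  commutator (z m * X ^+ k) (z n * X ^+ l)
  = ((c ^ n) ^+ k - (c ^ m) ^+ l) *: (z (m + n) * X ^+ (k + l)).
Proof.
by rewrite /commutator !zpow_expM scalerBl [n + m]addrC [(l + k)%N]addnC.
Qed.

End QCommuting.

(* With [c = q^(-1/2)] and [Ki = K^-1], so that [C = Ki^2], this covers both
   [(X, Y) = (A, B)] and, inverting [c], [(X, Y) = (B, A)]. *)
Record q_oscillator {F : fieldType} {V : algType F} (c a b : F)
    (K Ki X Y : V) : Prop := QOscillator {
  osc_KKi : K * Ki = 1;
  osc_KiK : Ki * K = 1;
  osc_XK : X * K = c *: (K * X);
  osc_YK : Y * K = c^-1 *: (K * Y);
  osc_YX : Y * X = a%:A - b *: Ki ^+ 2;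
  osc_XY : X * Y = a%:A - (c ^- 2 * b) *: Ki ^+ 2
}.

(** * The oscillator relations and their symmetry *)

Section QOscillator.
Context {F : fieldType} {V : algType F}.
Implicit Types (c a b : F) (K Ki X Y : V).

(** This symmetry transfers every result about powers of [X] to powers of [Y]. The new [b] is the
    coefficient of [Ki ^+ 2] in [X * Y]. *)
Lemma q_oscillatorC c a b K Ki X Y : c != 0 ->
  q_oscillator c a b K Ki X Y -> q_oscillator c^-1 a (c ^- 2 * b) K Ki Y X.
Proof.
move=> c0 [? ? XK YK YX XY]; split=> //; first by rewrite invrK.
by rewrite YX exprVn invrK mulrA mulfV ?mul1r ?expf_neq0.
Qed.


Definition osc_monomials K Ki X Y : set V :=
  [set x | exists n l, x = zpow K Ki n * X ^+ l \/ x = zpow K Ki n * Y ^+ l].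

Lemma osc_monomialsC K Ki X Y :
  osc_monomials K Ki X Y = osc_monomials K Ki Y X.
Proof.
by apply/seteqP; split=> x [n [l [->|->]]]; exists n, l; [right|left|right|left].
Qed.

Section Oscillator.
Context {c a b : F} {K Ki X Y : V}.
Hypotheses (c0 : c != 0) (osc : q_oscillator c a b K Ki X Y).
Local Notation z := (zpow K Ki).

Let KKi := osc_KKi osc.
Let KiK := osc_KiK osc.
Let XK := osc_XK osc.
Let YK := osc_YK osc.

Let zD := zpowD KKi KiK.
Let zY : forall n, Y * z n = _ := qcommute_zpow (invr_neq0 c0) KKi KiK YK.

Lemma osc_YzX n l :
  Y * (z n * X ^+ l.+1) = c ^ (- n) *: (a *: (z n * X ^+ l)
                                        - b *: (z (n - 2) * X ^+ l)).
Proof.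
rewrite mulrA zY exprz_inv -scalerAl exprS -mulrA [Y * _]mulrA (osc_YX osc).
congr (_ *: _); rewrite mulrBl mulrBr -!scalerAl -!scalerAr mul1r.
by rewrite mulrA -[Ki ^+ 2]/(z (-2)) -zD.
Qed.

Lemma osc_zXY n l :
  (z n * X ^+ l.+1) * Y = a *: (z n * X ^+ l)
                          - (c ^- 2 ^+ l.+1 * b) *: (z (n - 2) * X ^+ l).
Proof.
rewrite exprSr !mulrA -mulrA (osc_XY osc) mulrBr -!scalerAr mulr1.
congr (_ - _); rewrite -mulrA -[Ki ^+ 2]/(z (-2)).
rewrite (qcommute_exp_zpow c0 KKi KiK XK) -scalerAr mulrA -zD scalerA.
by congr (_ *: _); rewrite -[c ^ (-2)]/(c ^- 2) mulrAC -exprS.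
Qed.

(** Bracketing with [Y] removes one factor [X] and leaves two powers of [K] whose indices differ by
    2, since [Ki ^+ 2] is [z (-2)]. *)
Lemma osc_zXY_commutator n l :
  commutator (z n * X ^+ l.+1) Y
  = (a * (1 - c ^ (- n))) *: (z n * X ^+ l)
    - (b * (c ^- 2 ^+ l.+1 - c ^ (- n))) *: (z (n - 2) * X ^+ l).
Proof.
rewrite /commutator osc_zXY osc_YzX scalerBr !scalerA !mulrBr !mulr1 !scalerBl.
by rewrite ![_ * b]mulrC ![_ * a]mulrC !opprD !opprK addrACA.
Qed.

(** * Monomials generated by brackets *)

Section Generation.
Hypotheses (cU : forall n : int, n != 0 -> c ^ n != 1).
Variable L : set V.
Hypotheses (LL : lie_subalgebra L) (LK : L K) (LC : L (Ki ^+ 2)).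
Hypotheses (LX : L X).

Let LZ d x : d != 0 -> L (d *: x) -> L x.
Proof. by move=> d0 /(lsubZ d^-1 LL.1); rewrite scalerA mulVf // scale1r. Qed.

Let c_sub m n : m != n -> c ^ m - c ^ n != 0.
Proof.
move=> mn; rewrite subr_eq0; apply: contraNneq (@cU (m - n) _) => [cmn|].
  by rewrite expfzDr // cmn -expfzDr // subrr expr0z.
by rewrite subr_eq0.
Qed.

Lemma lie_mem_zX n : L (z n * X).
Proof.
have zXE := zpow_exp_commutator c0 KKi KiK XK.
(* Bracketing z_m X with z_k multiplies z_(m+k) X by c^k - 1, which is nonzero for k != 0. *)
have shift m k : L (z k) -> k != 0 -> L (z m * X) -> L (z (m + k) * X).
  move=> Lk k0 Lm; apply: (LZ (d := c ^ k - 1)); first by rewrite subr_eq0 cU.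
  have := LL.2 _ _ Lm Lk; have := zXE m k 1 0.
  by rewrite !expr1 !expr0 mulr1 => ->.
have Lz1 : L (z 1) by rewrite /= expr1.
have Lz2 : L (z (-2)) by [].
have Lz0 : L (z 0 * X) by rewrite mul1r.
elim/int_rec: n => [//|n /(shift _ _ Lz1) | n IHn].
  by rewrite -PoszD addn1; apply.
(* Only z_1 = K and z_(-2) = C are available, so one step down is made of +1 and -2. *)
have -> : - n.+1%:Z = - n%:Z + 1 + (-2) by lia.
by apply: (shift _ _ Lz2) => //; apply: (shift _ _ Lz1).
Qed.

Lemma lie_mem_zXl n l : L (z n * X ^+ l.+1).
Proof.
elim: l n => [|l IHl] n; first by rewrite expr1; exact: lie_mem_zX.
have zXE := zpow_exp_commutator c0 KKi KiK XK.
have split m k : m != k * l.+1%:Z -> L (z (k + m) * X ^+ l.+2).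
  move=> mk; apply: (LZ (d := c ^ m - c ^ (k * l.+1%:Z))); first exact: c_sub.
  have := LL.2 _ _ (lie_mem_zX k) (IHl m); have := zXE k m 1 l.+1.
  by rewrite !expr1 [(c ^ k) ^+ _]exprnP exprz_exp => ->.
(* The splitting n = 0 + n works unless n = 0, where both coefficients coincide; there 0 = 1 + (-1)
   is used. *)
have [->|n0] := eqVneq n 0.
  by rewrite -(subrr 1); apply: split; lia.
by rewrite -[n]add0r; apply: split; rewrite mul0r.
Qed.

Hypotheses (a0 : a != 0) (b0 : b != 0).

Lemma lie_mem_zpow n : L Y -> n != 0 -> L (z n).
Proof.
move=> LY; have step m : L ((a * (1 - c ^ (- m))) *: z m
                 - (b * (c ^- 2 - c ^ (- m))) *: z (m - 2)).
  have := LL.2 _ _ (lie_mem_zX m) LY; have := osc_zXY_commutator m 0.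
  by rewrite !expr1 !expr0 !mulr1 => ->.
have up m : m != 0 -> L (z (m - 2)) -> L (z m).
  move=> m0 Lm; apply: (LZ (d := a * (1 - c ^ (- m)))).
    by rewrite mulf_neq0 // subr_eq0 eq_sym cU // oppr_eq0.
  rewrite -[X in L X](subrK ((b * (c ^- 2 - c ^ (- m))) *: z (m - 2))).
  by apply: lsubD LL.1 (step m) _; apply: lsubZ LL.1 _.
have down m : m != 2 -> L (z m) -> L (z (m - 2)).
  move=> m2 Lm; apply: (LZ (d := b * (c ^- 2 - c ^ (- m)))).
    by rewrite mulf_neq0 // (@c_sub (-2)) //; lia.
  rewrite -[X in L X](subKr ((a * (1 - c ^ (- m))) *: z m)).
  by apply: lsubB LL.1 _ (step m); apply: lsubZ LL.1 _.
(* At m = 2 the coefficient of z_0 vanishes, so z_2 is isolated and starts the even positive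
   indices. *)
have L2 : L (z 2).
  apply: (LZ (d := a * (1 - c ^ (- 2)))).
    by rewrite mulf_neq0 // subr_eq0 eq_sym cU.
  by have := step 2; rewrite subrr mulr0 scale0r subr0.
(* Steps have length 2, so consecutive indices are carried together to cover both parities. *)
have Lpos k : L (z k.+1) /\ L (z k.+2).
  elim: k => [|k [Lk1 Lk2]]; first by split; rewrite //= expr1.
  split=> //; apply: up => //; have -> // : k.+3%:Z - 2 = k.+1 by lia.
(* The odd indices start from z_1, one step above z_(-1); the even ones start from the generator
   z_(-2), so z_0 is never crossed. *)
have Lneg k : L (z (- k.+1%:Z)) /\ L (z (- k.+2%:Z)).
  elim: k => [|k [Lk1 Lk2]].
    by split=> //; apply: (down 1) => //; rewrite /= expr1.
  split=> //; have -> : - k.+3%:Z = - k.+1%:Z - 2 by lia.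
  exact: down.
by case: n => [[|k]|k] // _; [case: (Lpos k)|rewrite NegzE; case: (Lneg k)].
Qed.

End Generation.

(** * Brackets of monomials with generators stay in the span *)

Section Closure.
Variable S : set V.
Hypotheses (SL : linear_subspace S) (Sz : forall n, n != 0 -> S (z n)).
Hypothesis SX : forall n l, S (z n * X ^+ l.+1).

Lemma commutator_zX_z n l m : S (commutator (z n * X ^+ l) (z m)).
Proof.
have := zpow_exp_commutator c0 KKi KiK XK n m l 0.
rewrite expr0 mulr1 addn0 => ->; case: l => [|l]; last exact: lsubZ.
by rewrite subrr scale0r; exact: lsub0.
Qed.

Lemma commutator_zX_X n l : S (commutator (z n * X ^+ l) X).
Proof.
have := zpow_exp_commutator c0 KKi KiK XK n 0 l 1.
by rewrite expr1 mul1r addn1 => ->; apply: lsubZ.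
Qed.

(* The coefficients of [osc_zXY_commutator] vanish exactly where it would
   involve [z 0 = 1]. *)
Lemma commutator_zX_Y n l : S (commutator (z n * X ^+ l.+1) Y).
Proof.
rewrite osc_zXY_commutator; case: l => [|l]; last by apply: lsubB => //; apply: lsubZ.
rewrite !expr0 !expr1 !mulr1; apply: lsubB => //.
  have [->|n0] := eqVneq n 0; last exact: lsubZ SL (Sz n0).
  by rewrite oppr0 expr0z subrr mulr0 scale0r; exact: lsub0.
have [->|n2] := eqVneq n 2; last by apply: lsubZ SL (Sz _); lia.
by rewrite -[c ^ (-2)]/(c ^- 2) subrr mulr0 scale0r; exact: lsub0.
Qed.

End Closure.

Lemma osc_span_mulz m t :
  lin_span (osc_monomials K Ki X Y) t ->
  lin_span (osc_monomials K Ki X Y) (z m * t).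
Proof.
have TL := lin_span_subspace (osc_monomials K Ki X Y).
apply: (lin_span_min (S := [set t | lin_span _ (z m * t)])).
  split=> [|d x y Tx Ty] /=; first by rewrite mulr0; exact: lsub0.
  by rewrite mulrDr -scalerAr; exact: TL.2.
move=> _ [n [l [->|->]]] /=; rewrite mulrA -zD; apply: mem_lin_span.
  by exists (m + n), l; left.
by exists (m + n), l; right.
Qed.

(** [Y] either joins a power of [Y] or cancels one [X] through [osc_YzX]. Multiplication by [X]
    follows from the symmetry. *)
Lemma osc_span_mulY t :
  lin_span (osc_monomials K Ki X Y) t -> lin_span (osc_monomials K Ki X Y) (Y * t).
Proof.
have TL := lin_span_subspace (osc_monomials K Ki X Y).
have TX n l : lin_span (osc_monomials K Ki X Y) (z n * X ^+ l).
  by apply: mem_lin_span; exists n, l; left.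
have TY n l : lin_span (osc_monomials K Ki X Y) (Y * (z n * Y ^+ l)).
  rewrite mulrA zY -scalerAl -mulrA -exprS; apply: lsubZ TL _.
  by apply: mem_lin_span; exists n, l.+1; right.
apply: (lin_span_min (S := [set t | lin_span _ (Y * t)])).
  split=> [|d x y Tx Ty] /=; first by rewrite mulr0; exact: lsub0.
  by rewrite mulrDr -scalerAr; exact: TL.2.
(* At exponent 0 there is no [X] to cancel, and the monomial is read as [z n * Y ^+ 0]. *)
move=> _ [n [[|l] [->|->]]] /=; [exact: (TY n 0)|exact: TY| |exact: TY].
by rewrite osc_YzX; apply: (lsubZ _ TL); apply: (lsubB TL); apply: (lsubZ _ TL).
Qed.

End Oscillator.

End QOscillator.

(** * Sequences annihilated by shift operators *)

Section Shifts.
Context {F : fieldType}.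
Implicit Types (f g : int -> F) (s t : seq F).

Definition shift_sub (x : F) f : int -> F := fun n => f (n + 1) - x * f n.

Definition shift_subs s f := foldr shift_sub f s.

Lemma shift_subsD s c f g n :
  shift_subs s (fun m => c * f m + g m) n = c * shift_subs s f n + shift_subs s g n.
Proof.
elim: s n => [//|x s IHs] n; rewrite /= /shift_sub -/(shift_subs s) !IHs.
by ring.
Qed.

(** All these operators are polynomials in one shift, so they commute. *)
Lemma shift_subs_comm s x f :
  shift_subs s (shift_sub x f) = shift_sub x (shift_subs s f).
Proof.
elim: s => [//|y s IHs] /=; rewrite IHs; apply/funext => n.
by rewrite /shift_sub; ring.
Qed.

Lemma shift_subs0 s : shift_subs s (fun=> 0) = fun=> 0.
Proof.
elim: s => [//|x s IHs] /=; rewrite IHs; apply/funext => n.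
by rewrite /shift_sub mulr0 subrr.
Qed.

Lemma shift_subs_cat s t f : shift_subs (s ++ t) f = shift_subs s (shift_subs t f).
Proof. exact: foldr_cat. Qed.

Lemma shift_subs_catC s t f : shift_subs (s ++ t) f = shift_subs (t ++ s) f.
Proof.
rewrite !shift_subs_cat.
elim: t => [//|x t IHt] /=; rewrite -IHt; exact: shift_subs_comm.
Qed.

(* Sequences such as the linear combinations of geometric sequences [x ^ n]
   with [x != 1]: a property separating them from the constant sequence 1. *)
Definition shift_killed f : Prop :=
  exists2 s, 1 \notin s & shift_subs s f = fun=> 0.

Lemma shift_killed0 : shift_killed (fun=> 0).
Proof. by exists [::]. Qed.

Lemma shift_killedD c f g :
  shift_killed f -> shift_killed g -> shift_killed (fun m => c * f m + g m).
Proof.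
move=> [s s1 sf] [t t1 tg]; exists (s ++ t); first by rewrite mem_cat negb_or s1.
(* For each summand the block that annihilates it has to act first, so the blocks are exchanged for
   [f] only. *)
apply/funext => n; rewrite shift_subsD [in X in X + _]shift_subs_catC.
by rewrite !shift_subs_cat sf tg !shift_subs0 mulr0 add0r.
Qed.

Lemma shift_killed_geometric x f :
  x != 1 -> (forall n, f (n + 1) = x * f n) -> shift_killed f.
Proof.
move=> x1 fE; exists [:: x]; first by rewrite inE eq_sym.
by apply/funext => n; rewrite /= /shift_sub fE subrr.
Qed.

Lemma shift_killedN1 : ~ shift_killed (fun=> 1).
Proof.
move=> [s s1 /(congr1 (fun f => f 0)) /eqP]; apply/negP.
(* On constants each factor is multiplication by 1 - x, and no such scalar is zero. *)
suff -> : shift_subs s (fun=> 1) = fun=> \prod_(x <- s) (1 - x).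
  rewrite prodf_seq_neq0; apply/allP => x xs /=.
  by rewrite subr_eq0; apply: contraNneq s1 => ->.
elim: s {s1} => [|x s IHs]; first by apply/funext => n; rewrite big_nil.
apply/funext => n; rewrite big_cons /= /shift_sub -/(shift_subs s _) IHs.
by ring.
Qed.

End Shifts.

(** * The algebra as an oscillator, and its representation *)

Section Palg.
Context {R : realType} {w : R}.
Local Notation P := (Palg w).
Local Notation K := (pK w).
Local Notation A := (pA w).
Local Notation B := (pB w).
Local Notation C := (pC w).
Local Notation Ki := (pK w * pC w).
Local Notation z := (zpow (pK w) (pK w * pC w)).
Local Notation c := (qpow w (- 2^-1)).
Local Notation a := ((1 - qpow w 1)^-1).

Lemma Palg_ind (Q : P -> Prop) :
    Q K -> Q A -> Q B -> Q C -> (forall d, Q d%:A) ->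
    (forall x y, Q x -> Q y -> Q (x + y)) ->
    (forall x y, Q x -> Q y -> Q (x * y)) -> forall x, Q x.
Proof.
move=> QK QA QB QC Q1 QD QM x; have [t ->] := pclass_surj x.
elim: t => [[]|d|t IHt u IHu|t IHt u IHu] //.
- have := Q1 d; rewrite -[d%:A]/(pmul _ _).
  by rewrite (pmul1r (pclass (@Prel R w) (TConst _ d))).
- by rewrite pclassD; exact: QD.
- by rewrite pclassM; exact: QM.
Qed.

Lemma qpow_half_exp n : c ^ n = qpow w (- 2^-1 * n%:~R).
Proof.
have qV x : qpow w (- x) = (qpow w x)^-1.
  have := qpowD w (- x) x; rewrite addNr qpow0 => q1.
  have q0 : qpow w x != 0.
    by apply/eqP => q0; move: q1; rewrite q0 mulr0 => /eqP; rewrite oner_eq0.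
  by apply: (mulIf q0); rewrite -q1 mulVf.
have qn (k : nat) : c ^ k = qpow w (- 2^-1 * k%:R).
  elim: k => [|k IHk]; first by rewrite mulr0 qpow0.
  by rewrite exprSz IHk -qpowD -natr1; congr qpow; ring.
case: n => n; first exact: qn.
by rewrite NegzE -exprnN -[c ^+ _]/(c ^ n.+1%:Z) qn -qV rmorphN mulrN.
Qed.

Lemma qpow_half_neq0 : c != 0.
Proof. by rewrite eq_complex /= gt_eqF // powR_gt0 // expR_gt0. Qed.

Lemma qpow_neq1 x : w != 0 -> x != 0 -> qpow w x != 1.
Proof.
move=> w0 x0; rewrite /qpow /qpar eq_complex /= eqxx andbT.
rewrite -expRM -expR0 (inj_eq (@expR_inj _)).
by rewrite !mulf_neq0 // oppr_eq0.
Qed.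

Lemma qpow_half_not_root n : w != 0 -> n != 0 -> c ^ n != 1.
Proof.
by move=> w0 n0; rewrite qpow_half_exp qpow_neq1 // mulf_neq0 ?intr_eq0.
Qed.

(** Since C commutes with K, the relation K^2 C = 1 makes KC a two-sided inverse of K, and (KC)^2 =
    (K^2 C) C = C. *)
Lemma pC_KiK : (Ki ^+ 2 = C) /\ (Ki * K = 1) /\ (K * Ki = 1).
Proof.
have [_ [_ _ CK KKC]] := P_relations w.
have KKi : K * Ki = 1 by rewrite mulrA -expr2.
by rewrite -mulrA CK KKi; do ![split]; rewrite expr2 -!mulrA [C * _]mulrA CK
  !mulrA -[K * K * C]mulrA KKi mul1r.
Qed.

Lemma Palg_oscillator : q_oscillator c a a K Ki A B.
Proof.
have [[AB BA _ _] [AK BK CK KKC]] := P_relations w.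
have [KiC [KiK KKi]] := pC_KiK.
have c1 : c^-1 = qpow w 2^-1.
  by rewrite -exprN1 qpow_half_exp; congr qpow; ring.
have c2 : c ^- 2 = qpow w 1.
  by rewrite -[c ^- 2]/(c ^ (-2)) qpow_half_exp; congr qpow; field.
split=> //; first by rewrite c1.
  by rewrite BA scalerBr KiC.
by rewrite AB scalerBr KiC scalerA c2 mulrC.
Qed.

(** The choice of a representative is harmless because [Prep] respects the congruence. *)
Definition Pact (x : P) (f : int -> R[i]) : int -> R[i] :=
  Prep w (repr (x : presented (@Prel R w))) f.

Lemma PactE t f : Pact (pclass (@Prel R w) t) f = Prep w t f.
Proof. by rewrite /Pact (Prep_pcongr (pcongr_repr _ t)). Qed.

Lemma PactM (x y : P) f : Pact (x * y) f = Pact x (Pact y f).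
Proof.
have [t ->] := pclass_surj x; have [u ->] := pclass_surj y.
by rewrite -[_ * _]/(pmul _ _) -pclassM !PactE.
Qed.

Lemma PactD d (x y : P) f n : Pact (d *: x + y) f n = d * Pact x f n + Pact y f n.
Proof.
have [t ->] := pclass_surj x; have [u ->] := pclass_surj y.
rewrite -[_ *: _ + _]/(padd (pmul (pclass _ (TConst _ d)) _) _).
by rewrite -pclassM -pclassD !PactE.
Qed.

Lemma Pact0 f : Pact 0 f = fun=> 0.
Proof. by rewrite (PactE (TConst _ 0)); apply/funext => n /=; rewrite mul0r. Qed.

Lemma Pact1 f : Pact 1 f = f.
Proof. by rewrite (PactE (TConst _ 1)); apply/funext => n /=; rewrite mul1r. Qed.

Lemma PactK f n : Pact K f n = c ^ n * f n.
Proof. by rewrite PactE qpow_half_exp. Qed.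

Lemma PactKi f n : Pact Ki f n = c ^ (- n) * f n.
Proof.
rewrite PactM PactK PactE /= mulrA !qpow_half_exp -qpowD; congr (qpow _ _ * _).
by rewrite rmorphN /=; field.
Qed.

Lemma Pact_zpow k f n : Pact (z k) f n = c ^ (n * k) * f n.
Proof.
case: k => k /=.
  elim: k => [|k IHk]; first by rewrite expr0 Pact1 mulr0 mul1r.
  rewrite exprS PactM PactK IHk mulrA -expfzDr ?qpow_half_neq0 //.
  by congr (_ ^ _ * _); lia.
rewrite NegzE; elim: k => [|k IHk].
  by rewrite expr1 PactKi; congr (_ ^ _ * _); lia.
rewrite exprS PactM PactKi IHk mulrA -expfzDr ?qpow_half_neq0 //.
by congr (_ ^ _ * _); lia.
Qed.

Lemma Pact_expA l f n : Pact (A ^+ l) f n = f (n + l%:Z).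
Proof.
elim: l n => [|l IHl] n; first by rewrite expr0 Pact1 addr0.
by rewrite exprS PactM PactE /= IHl; congr f; lia.
Qed.

(** The scalar is left unspecified: only the displacement by [l] matters for diagonal entries. *)
Lemma Pact_expB l f n : exists d, Pact (B ^+ l) f n = d * f (n - l%:Z).
Proof.
elim: l n => [|l IHl] n; first by exists 1; rewrite expr0 Pact1 subr0 mul1r.
rewrite exprS PactM PactE /=; have [d ->] := IHl (n - 1).
by rewrite mulrA; eexists; congr (_ * f _); lia.
Qed.

(** The (n, n) matrix entry of [x] with respect to the delta functions. *)
Definition Pdiag (x : P) (n : int) : R[i] := Pact x (fun m => (m == n)%:R) n.

Lemma Pdiag_subspace : linear_subspace [set x | shift_killed (Pdiag x)].
Proof.
split=> [|d x y] /=.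
  rewrite (_ : Pdiag 0 = fun=> 0); first exact: shift_killed0.
  by apply/funext => n; rewrite /Pdiag Pact0.
rewrite (_ : Pdiag (d *: x + y) = fun n => d * Pdiag x n + Pdiag y n).
  exact: shift_killedD.
by apply/funext => n; rewrite /Pdiag PactD.
Qed.

(** The entries c^(mn) are geometric in m with ratio c^n, which differs from 1. *)
Lemma Pdiag_zpow n : w != 0 -> n != 0 -> shift_killed (Pdiag (z n)).
Proof.
move=> w0 n0; apply: (shift_killed_geometric (qpow_half_not_root w0 n0)) => m.
rewrite /Pdiag !Pact_zpow !eqxx !mulr1 -expfzDr ?qpow_half_neq0 //.
by congr (_ ^ _); lia.
Qed.

Lemma Pdiag_zpowA n l : shift_killed (Pdiag (z n * A ^+ l.+1)).
Proof.
rewrite (_ : Pdiag _ = fun=> 0); first exact: shift_killed0.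
apply/funext => m; rewrite /Pdiag PactM Pact_zpow Pact_expA.
by rewrite (_ : _ == _ = false) ?mulr0 //; lia.
Qed.

Lemma Pdiag_zpowB n l : shift_killed (Pdiag (z n * B ^+ l.+1)).
Proof.
rewrite (_ : Pdiag _ = fun=> 0); first exact: shift_killed0.
apply/funext => m; rewrite /Pdiag PactM Pact_zpow.
have [d ->] := Pact_expB l.+1 (fun k => (k == m)%:R) m.
by rewrite (_ : _ == _ = false) ?mulr0 //; lia.
Qed.

Lemma Pdiag_neq1 (x : P) : shift_killed (Pdiag x) -> x != 1.
Proof.
move=> xW; apply/eqP => x1; apply: (@shift_killedN1 R[i]).
rewrite (_ : (fun=> 1) = Pdiag x) //; apply/funext => n.
by rewrite x1 /Pdiag Pact1 eqxx.
Qed.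

Lemma zpow_KC h k : K ^+ h * C ^+ k = z (h%:Z - 2 * k%:Z).
Proof.
have [KiC [KiK KKi]] := pC_KiK.
rewrite (zpowD KKi KiK); congr (_ * _); rewrite -[C in LHS]KiC -exprM.
case: k => [|k]; first by rewrite muln0 mulr0.
have -> : - (2 * k.+1%:Z) = Negz (2 * k).+1 by lia.
by rewrite mulnS.
Qed.

Lemma KC_zpow n : exists h k, ((1 <= k)%N -> h \in [:: 0%N; 1%N]) /\
  z n = K ^+ h * C ^+ k.
Proof.
case: n => n; first by exists n, 0; rewrite expr0 mulr1.
(* For the index -N with N = n + 1, take h as the parity of N and k = ceil(N/2), so that h - 2k = -N
   and h is at most 1. *)
exists (odd n.+1 : nat), (uphalf n.+1); split=> [_|]; first by case: odd.
by rewrite zpow_KC; congr zpow; lia.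
Qed.

End Palg.

(** * The span without 1 equals the generated Lie algebra *)

Section Span.
Context {R : realType} {w : R}.
Hypothesis w0 : w != 0.
Local Notation P := (Palg w).
Local Notation K := (pK w).
Local Notation A := (pA w).
Local Notation B := (pB w).
Local Notation C := (pC w).
Local Notation Ki := (pK w * pC w).
Local Notation z := (zpow (pK w) (pK w * pC w)).
Local Notation c := (qpow w (- 2^-1)).
Local Notation a := ((1 - qpow w 1)^-1).
Local Notation S := (lin_span (Pmonomials w `\ 1)).

Lemma Pmonomial_cases x : Pmonomials w x ->
  exists n, [\/ x = z n, exists l, x = z n * B ^+ l.+1 |
                exists l, x = z n * A ^+ l.+1].
Proof.
move=> [h [k [_ [->|[[|l] // _ ->]|[[|l] // _ ->]]]]]; rewrite zpow_KC.
- by eexists; constructor 1.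
- by eexists; constructor 2; exists l.
- by eexists; constructor 3; exists l.
Qed.

Lemma span_zpow n : n != 0 -> S (z n).
Proof.
move=> n0; apply: mem_lin_span; split; last first.
  exact/eqP/Pdiag_neq1/Pdiag_zpow.
have [h [k [hk ->]]] := @KC_zpow _ w n.
by exists h, k; split=> //; constructor 1.
Qed.

Lemma span_zpowA n l : S (z n * A ^+ l.+1).
Proof.
apply: mem_lin_span; split; last exact/eqP/Pdiag_neq1/Pdiag_zpowA.
have [h [k [hk ->]]] := @KC_zpow _ w n.
by exists h, k; split=> //; constructor 3; exists l.+1.
Qed.

Lemma span_zpowB n l : S (z n * B ^+ l.+1).
Proof.
apply: mem_lin_span; split; last exact/eqP/Pdiag_neq1/Pdiag_zpowB.
have [h [k [hk ->]]] := @KC_zpow _ w n.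
by exists h, k; split=> //; constructor 2; exists l.+1.
Qed.

Lemma span_not1 : ~ S 1.
Proof.
move=> S1; suff : [set x : P | shift_killed (Pdiag x)] 1.
  by move/Pdiag_neq1; rewrite eqxx.
apply: lin_span_min S1; first exact: Pdiag_subspace.
move=> x [/Pmonomial_cases [n [->|[l ->]|[l ->]]] n1] /=.
- apply: Pdiag_zpow => //; apply/eqP => n0; apply: n1.
  by rewrite n0.
- exact: Pdiag_zpowB.
- exact: Pdiag_zpowA.
Qed.

Lemma span_osc_monomials x : lin_span (osc_monomials K Ki A B) x.
Proof.
pose T := lin_span (osc_monomials K Ki A B); rewrite -/(T x).
have TL : linear_subspace T := lin_span_subspace _.
have osc := @Palg_oscillator _ w; have c0 := @qpow_half_neq0 _ w.
(* The span contains 1, so it is everything once it is a left ideal; this is checked on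
   generators. *)
suff Tx t : T t -> T (x * t).
  rewrite -[x]mulr1; apply: Tx; apply: mem_lin_span.
  by exists 0, 0; left; rewrite mulr1.
elim/(@Palg_ind R w): x t => [| | | |d|x y IHx IHy|x y IHx IHy] t Tt.
- by have := osc_span_mulz osc 1 Tt; rewrite /= expr1.
- rewrite /T osc_monomialsC; apply: (osc_span_mulY (invr_neq0 c0) (q_oscillatorC c0 osc)).
  by rewrite -osc_monomialsC.
- exact: (osc_span_mulY c0 osc).
- by have := osc_span_mulz osc (-2) Tt; rewrite [z _](proj1 pC_KiK).
- by rewrite mulr_algl; apply: (lsubZ _ TL).
- by rewrite mulrDl; apply: (lsubD TL); [exact: IHx|exact: IHy].
- by rewrite -mulrA; apply: IHx; exact: IHy.
Qed.

Lemma span_commutator x y : S (commutator x y).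
Proof.
have SL : linear_subspace S := lin_span_subspace _.
have osc := @Palg_oscillator _ w; have c0 := @qpow_half_neq0 _ w.
have osc' := q_oscillatorC c0 osc; have c0' := invr_neq0 c0.
have mono (u : P) : (forall n l, S (commutator (z n * A ^+ l) u)) ->
    (forall n l, S (commutator (z n * B ^+ l) u)) -> forall v, S (commutator v u).
  move=> uA uB v; apply: (lin_span_min (S := [set v | S (commutator v u)])
    _ _ (span_osc_monomials v)).
    split=> [|d s t Ss St] /=; first by rewrite commutator0l; exact: lsub0.
    by rewrite commutatorDl commutatorZl; exact: SL.2.
  by move=> _ [n [l [->|->]]]; [exact: uA|exact: uB].
have zS m v : S (commutator v (z m)).
  apply: mono v => n l.
    exact: (commutator_zX_z c0 osc SL span_zpowA).
  exact: (commutator_zX_z c0' osc' SL span_zpowB).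
elim/(@Palg_ind R w): y x => [| | | |d|y t IHy IHt|y t IHy IHt] x.
- by have := zS 1 x; rewrite /= expr1.
- apply: mono x => n l.
    exact: (commutator_zX_X c0 osc SL span_zpowA).
  (* For exponent 0 the element is z_n alone, read as z_n A^0, which falls under the bracket with A;
     the next case is symmetric. *)
  case: l => [|l]; last exact: (commutator_zX_Y c0' osc' SL span_zpow span_zpowB).
  exact: (commutator_zX_X c0 osc SL span_zpowA n 0).
- apply: mono x => n l; last exact: (commutator_zX_X c0' osc' SL span_zpowB).
  case: l => [|l]; last exact: (commutator_zX_Y c0 osc SL span_zpow span_zpowA).
  exact: (commutator_zX_X c0' osc' SL span_zpowB n 0).
- by have := zS (-2) x; rewrite [z _](proj1 pC_KiK).
- by rewrite /commutator mulr_algl mulr_algr subrr; exact: lsub0.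
- by rewrite commutatorDr; apply: (lsubD SL).
- by rewrite commutatorMr; apply: (lsubD SL).
Qed.

Lemma lie_generated_eq_span : lie_generated [set K; A; B; C] = S.
Proof.
have osc := @Palg_oscillator _ w; have c0 := @qpow_half_neq0 _ w.
apply/seteqP; split.
  apply: bigcap_inf; split.
    by split=> [|x y _ _]; [exact: lin_span_subspace|exact: span_commutator].
  move=> x [[[->|->]|->]|->].
  - by have := @span_zpow 1 isT; rewrite /= expr1.
  - by have := span_zpowA 0 0; rewrite mul1r expr1.
  - by have := span_zpowB 0 0; rewrite mul1r expr1.
  - by have := @span_zpow (-2) isT; rewrite [z _](proj1 pC_KiK).
set L := lie_generated _.
have LL : lie_subalgebra L := lie_generated_subalgebra _.
have [LK LA LB LC] : [/\ L K, L A, L B & L C].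
  by split=> H [_]; apply; do ?[by left|by right|left].
rewrite -(proj1 pC_KiK) in LC.
have cU m : m != 0 -> c ^ m != 1 by exact: qpow_half_not_root.
have cU' m : m != 0 -> c^-1 ^ m != 1.
  by rewrite exprz_inv -oppr_eq0; apply: cU.
have a0 : a != 0 by rewrite invr_neq0 // subr_eq0 eq_sym qpow_neq1 ?oner_eq0.
apply: (lin_span_min LL.1) => x [/Pmonomial_cases [n xE] x1].
case: xE x1 => [->|[l ->]|[l ->]] x1.
- apply: (lie_mem_zpow c0 osc cU LL LK LC LA a0 a0 LB).
  by apply/eqP => n0; apply: x1; rewrite n0.
- exact: (lie_mem_zXl (invr_neq0 c0) (q_oscillatorC c0 osc) cU' LL LK LC LB).
- exact: (lie_mem_zXl c0 osc cU LL LK LC LA).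
Qed.

Lemma Palg_decomposition x : exists e y, S y /\ x = e%:A + y.
Proof.
have SL : linear_subspace S := lin_span_subspace _.
pose Q := [set x : P | exists e y, S y /\ x = e%:A + y].
apply: (lin_span_min (S := Q) _ _ (span_osc_monomials x)).
  split; first by exists 0, 0; rewrite scale0r addr0; split=> //; exact: lsub0.
  move=> d _ _ [e [y [Sy ->]]] [e' [y' [Sy' ->]]].
  exists (d * e + e'), (d *: y + y'); split; first exact: SL.2.
  by rewrite scalerDr scalerA addrACA scalerDl.
have Qz n : Q (z n).
  have [->|n0] := eqVneq n 0.
    by exists 1, 0; rewrite scale1r addr0; split=> //; exact: lsub0.
  by eexists 0, _; rewrite scale0r add0r; split; first exact: span_zpow n0.
move=> _ [n [[|l] [->|->]]].
- by rewrite mulr1; exact: Qz.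
- by rewrite mulr1; exact: Qz.
- by eexists 0, _; rewrite scale0r add0r; split; first exact: (span_zpowA n l).
- by eexists 0, _; rewrite scale0r add0r; split; first exact: (span_zpowB n l).
Qed.

End Span.

(** * The Lie algebra as a complement of the scalars *)

Theorem theorem4p3 (R : realType) (w : R) (w_neq0 : w != 0) :
  let L : set (Palg w) := lie_generated [set pK w; pA w; pB w; pC w] in
  L = lin_span (Pmonomials w `\ 1) /\ direct_sum (lin_span [set 1]) L.
Proof.
move=> L; have LE : L = lin_span (Pmonomials w `\ 1) := lie_generated_eq_span w_neq0.
have LL : linear_subspace L by rewrite LE; exact: lin_span_subspace.
have L1 : ~ L 1 by rewrite LE; exact: span_not1.
split=> // x; have [e [y [Ly ->]]] := Palg_decomposition w_neq0 x.
rewrite -LE in Ly.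
exists (e%:A, y); split=> [|[_ y'] /= [/lin_span1P [e' ->] Ly' eE]].
  by split=> //=; apply: (lsubZ _ (lin_span_subspace _)); exact: mem_lin_span.
suff ee' : e = e' by move: eE; rewrite ee' => /addrI ->.
(* Two decompositions with different scalars would put a nonzero multiple of 1 into [L]. *)
apply/eqP; rewrite -subr_eq0; apply/negPn/negP => d0; apply: L1.
have dE : (e - e')%:A = y' - y.
  by rewrite scalerBl; apply/eqP; rewrite subr_eq addrAC -subr_eq opprK eE addrC.
have : L ((e - e')^-1 *: (y' - y)) by apply: (lsubZ _ LL); exact: (lsubB LL).
by rewrite -dE scalerA mulVf // scale1r.
Qed.
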